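(* Let $0<\alpha<1$, let $N(t)=N_1(\Lambda(t))$ be the non-homogeneous Poisson process with intensity function $\lambda$, and let $Y_\alpha$ be the inverse stable subordinator independent of $N$. Then for $t>0$ $$\mathbb{E}[N(Y_\alpha(t))]=\int_0^\infty\Lambda(x)\,h_\alpha(t,x)\,\mathrm{d}x=\int_0^\infty\int_0^x\lambda(\tau)\,h_\alpha(t,x)\,\mathrm{d}\tau\,\mathrm{d}x=\mathbb{E}[\Lambda(Y_\alpha(t))].$$
   Context: The intensity is a function $\lambda:[0,\infty)\to[0,\infty)$, and $\Lambda(t)=\int_0^t\lambda(u)\,\mathrm{d}u$ (assumed finite). $N_1=\{N_1(t),t\ge 0\}$ is a homogeneous Poisson process with intensity $1$, independent of $Y_\alpha$. $L_\alpha=\{L_\alpha(t),t\ge 0\}$ is the $\alpha$-stable subordinator with $\mathbb{E}[\exp(-sL_\alpha(t))]=\exp(-ts^\alpha)$, $s\ge 0$. Its inverse is $Y_\alpha(t)=\inf\{u\ge 0: L_\alpha(u)>t\}$. For $t>0$, $Y_\alpha(t)$ has density $$h_\alpha(t,x)=\frac{t}{\alpha x^{1+1/\alpha}}\,g_\alpha\!\left(\frac{t}{x^{1/\alpha}}\right),\quad x>0,$$ where $g_\alpha$ is the density of $L_\alpha(1)$. Expectations of non-negative quantities are taken in $[0,\infty]$. *)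

(* Defs.v *)
From HB Require Import structures.
From mathcomp Require Import all_boot all_order all_algebra.
From mathcomp Require Import all_classical all_reals all_analysis.

Set Implicit Arguments.
Unset Strict Implicit.
Unset Printing Implicit Defensive.

Import Order.TTheory GRing.Theory Num.Theory.
Import numFieldNormedType.Exports.

Local Open Scope classical_set_scope.
Local Open Scope ring_scope.

(* Processes {X(t), t >= 0} are functions [X : R -> T -> R]; only the values at
   times [t >= 0] are ever constrained or used. *)

Section processes.
Context d (T : measurableType d) (R : realType).
Implicit Types (P : probability T R) (X Y L : R -> T -> R) (N : R -> T -> nat).

(* The existence of left limits, hence cadlag paths, follows from
   monotonicity. *)
Definition increasing_process X :=
  [/\ forall t : R, 0 <= t -> measurable_fun [set: T] (X t),
      forall w, X 0 w = 0,
      forall w (s t : R), 0 <= s -> s <= t -> X s w <= X t w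
    & forall w (t : R), 0 <= t -> X u w @[u --> t^'+] --> X t w].

Definition increment X (s t : R) : T -> R := fun w => X t w - X s w.

Definition independent_increments P X :=
  forall (n : nat) (t : nat -> R) (B : nat -> set R),
    0 <= t 0%N -> (forall i, (i < n)%N -> t i <= t i.+1) ->
    (forall i, measurable (B i)) ->
  P (\bigcap_(i < n) (increment X (t i) (t i.+1) @^-1` B i)) =
  (\prod_(i < n) P (increment X (t i) (t i.+1) @^-1` B i))%E.

Definition stationary_increments P X :=
  forall (s h : R) (B : set R), 0 <= s -> 0 <= h -> measurable B ->
  P (increment X s (s + h) @^-1` B) = P (increment X 0 h @^-1` B).

Definition subordinator P X :=
  [/\ increasing_process X, independent_increments P X
    & stationary_increments P X].

Definition stable_subordinator P (alpha : R) L :=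
  subordinator P L /\
  forall s t : R, 0 <= s -> 0 <= t ->
    ('E_P[fun w => expR (- (s * L t w))] = (expR (- (t * s `^ alpha)))%:E)%E.

(* For a stable subordinator the set below is almost surely nonempty; [inf] is
   [0] on the null event where it is empty. *)
Definition inverse_process L (t : R) : T -> R :=
  fun w => inf [set u | 0 <= u /\ t < L u w].

Definition real_process N : R -> T -> R := fun t w => (N t w)%:R.

(* The library's [poisson_pmf] is not used, because it is [1] when its parameter
   is [0]. *)
Definition poisson_process P (rate : R) N :=
  [/\ increasing_process (real_process N),
      independent_increments P (real_process N)
    & forall (s t : R) (k : nat), 0 <= s -> s <= t ->
        P [set w | N t w = (N s w + k)%N] =
        ((rate * (t - s)) ^+ k / k`!%:R * expR (- (rate * (t - s))))%:E].

Definition process_sigma_algebra X : set (set T) :=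
  <<s [set A | exists (t : R) (B : set R),
        [/\ 0 <= t, measurable B & A = X t @^-1` B]] >>.

Definition independent_processes P X Y :=
  forall A B, process_sigma_algebra X A -> process_sigma_algebra Y B ->
  P (A `&` B) = (P A * P B)%E.

Definition has_density P (Z : T -> R) (g : R -> R) :=
  [/\ measurable_fun [set: R] g, forall x, 0 <= g x
    & forall B : set R, measurable B ->
        P (Z @^-1` B) = (\int[lebesgue_measure]_(x in B) (g x)%:E)%E].

End processes.

Section intensity.
Context (R : realType).

Definition intensity (lambda : R -> R) :=
  (forall u : R, 0 <= u -> 0 <= lambda u) /\
  (forall t : R, 0 <= t ->
     lebesgue_measure.-integrable `[0, t] (EFin \o lambda)).

Definition cumulative_intensity (lambda : R -> R) (t : R) : R :=
  \int[lebesgue_measure]_(u in `[0, t]) lambda u.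

Definition nonhomogeneous_poisson (T : Type) (N1 : R -> T -> nat)
    (lambda : R -> R) : R -> T -> nat :=
  fun t => N1 (cumulative_intensity lambda t).

(* Density at [x > 0] of the inverse at time [t] of the stable subordinator
   [L], where [g] is the density of [L 1]. *)
Definition inverse_stable_density (alpha : R) (g : R -> R) (t x : R) : R :=
  t / (alpha * x `^ (1 + alpha^-1)) * g (t / x `^ alpha^-1).

End intensity.

(* Main.v *)
Require Import Defs.
From HB Require Import structures.
From mathcomp Require Import all_boot all_order all_algebra.
From mathcomp Require Import all_classical all_reals all_analysis.
From mathcomp Require Import measurable_realfun.
From mathcomp Require Import ring lra.

Set Implicit Arguments.
Unset Strict Implicit.
Unset Printing Implicit Defensive.

Import Order.TTheory GRing.Theory Num.Theory.
Import numFieldNormedType.Exports.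

Local Open Scope classical_set_scope.
Local Open Scope ring_scope.

(** Two facts are combined. First, [N1 s] has mean [s], and the process
    [N = N1 o Lambda] is independent of the random time [Y t]; conditioning on
    that time, i.e. integrating against the product law of the time and the path
    of [N], gives E N(Y t) = E Lambda(Y t) ([poisson_time_change_mean]). This
    needs [N] to be jointly measurable in time and path, which holds because its
    paths are nondecreasing and right-continuous
    ([ge0_integral_independent_time]).

    Second, [Y t] has density [inverse_stable_density alpha g t] on the positive
    half-line ([ge0_integral_inverse_process]). Up to a null event, [Y t < x]
    means that [L] has passed above [t] strictly before time [x]. The Laplace
    transform of [L x] is that of x^(1/alpha) L(1), so both have the same tails
    ([laplace_inj_tail]), and P(L x > t) = P((t / L 1)^alpha < x). Hence [Y t]
    has the law of (t / L 1)^alpha, and the density of [L 1] is transported by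
    the substitution z = t / x^(1/alpha). As [g] is only measurable, this
    substitution is an equality of measures, checked on the rays ]-oo, b[
    ([ge0_integration_by_substitution_inverse_power]).

    Applied to [Lambda], the second fact gives the single integral; the double
    integral is the same one with the definition of [Lambda] unfolded. *)

(** * Measures with a density *)
Section density_measure.
Context d (T : measurableType d) (R : realType).
Variables (mu : {measure set T -> \bar R}) (g : T -> R).
Hypotheses (mg : measurable_fun [set: T] g) (g0 : forall x, 0 <= g x).
Local Open Scope ereal_scope.

(** The two proof arguments let the measure structure be inferred from the term
    itself. *)
Definition density_measure of measurable_fun [set: T] g
    & (forall x, (0 <= g x)%R) : set T -> \bar R :=
  fun A => \int[mu]_(x in A) (g x)%:E.

Local Notation nu := (density_measure mg g0).

Let nu0 : nu set0 = 0.
Proof. exact: integral_set0. Qed.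

Let nu_ge0 A : 0 <= nu A.
Proof. by apply: integral_ge0 => x _; rewrite lee_fin. Qed.

Let nu_sigma_additive : semi_sigma_additive nu.
Proof.
move=> /= A mA tA mUA.
rewrite /density_measure /= ge0_integral_bigcup //=; last 2 first.
- by apply/measurable_funTS/measurable_EFinP.
- by move=> x _; rewrite lee_fin.
by apply: is_cvg_ereal_nneg_natsum_cond => n _ _; exact: nu_ge0.
Qed.

HB.instance Definition _ :=
  isMeasure.Build _ _ _ nu nu0 nu_ge0 nu_sigma_additive.

Import HBNNSimple.

(** By monotone convergence it is enough to treat simple functions, hence
    indicators, for which the identity is the definition of the measure. *)
Lemma ge0_integral_density (f : T -> \bar R) :
    measurable_fun [set: T] f -> (forall x, 0 <= f x) ->
  \int[nu]_x f x = \int[mu]_x (f x * (g x)%:E).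
Proof.
move=> mf f0; pose h := nnsfun_approx measurableT mf.
have mgE : measurable_fun [set: T] (EFin \o g) by exact/measurable_EFinP.
have mh n : measurable_fun [set: T] (EFin \o h n).
  by apply/measurable_EFinP; exact/measurable_funP.
have cvh x : (EFin \o h n) x @[n --> \oo] --> f x.
  by apply: cvg_nnsfun_approx.
have ndh x a b : (a <= b)%N -> (h a x <= h b x)%R.
  by move=> ab; exact/lefP/nd_nnsfun_approx.
have -> : \int[nu]_x f x = limn (fun n => \int[nu]_x (h n x)%:E).
  rewrite -monotone_convergence //.
  - by apply: eq_integral => x _; apply/esym/cvg_lim => //; exact: (cvh x).
  - by move=> n x _; rewrite lee_fin.
  - by move=> x _ a b ab; rewrite lee_fin ndh.
have -> : \int[mu]_x (f x * (g x)%:E) =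
    limn (fun n => \int[mu]_x ((h n x)%:E * (g x)%:E)).
  rewrite -monotone_convergence //.
  - apply: eq_integral => x _; apply/esym/cvg_lim => //.
    apply: cvgeZr => //.
    exact: (cvh x).
  - by move=> n; apply: emeasurable_funM => //; exact: mh.
  - by move=> n x _; rewrite mule_ge0 ?lee_fin.
  - by move=> x _ a b ab; rewrite lee_wpmul2r ?lee_fin ?ndh.
(* What remains is the identity for the simple function [h n]. *)
congr (limn _); apply/funext => n.
have mfib r : measurable (h n @^-1` [set r]) by [].
have mind r : measurable_fun [set: T]
    (fun x => (r * \1_(h n @^-1` [set r]) x)%:E).
  by apply/measurable_EFinP; apply: measurable_funM.
transitivity (\sum_(r \in range (h n))
    \int[nu]_x (r * \1_(h n @^-1` [set r]) x)%:E).
  under eq_integral do rewrite fimfunE -fsumEFin//.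
  rewrite ge0_integral_fsum// => r x _; exact: nnfun_muleindic_ge0.
transitivity (\sum_(r \in range (h n))
    \int[mu]_x ((r * \1_(h n @^-1` [set r]) x)%:E * (g x)%:E)); last first.
  rewrite -ge0_integral_fsum//.
  - apply: eq_integral => x _; rewrite [in RHS]fimfunE -fsumEFin//.
    by rewrite ge0_mule_fsuml// => r; exact: nnfun_muleindic_ge0.
  - by move=> r; exact: emeasurable_funM.
  - by move=> r x _; rewrite mule_ge0 ?lee_fin// -lee_fin nnfun_muleindic_ge0.
apply: eq_fsbigr => r /[!inE] -[x0 _ hr].
rewrite integralZl_indic_nnsfun// integral_indic// setIT /=.
have r0 : (0 <= r)%R by rewrite -hr.
under [RHS]eq_integral do rewrite EFinM -muleA.
rewrite ge0_integralZl//; last first.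
- by move=> x _; rewrite mule_ge0 ?lee_fin.
- by apply: emeasurable_funM => //; apply/measurable_EFinP.
congr (_ * _); rewrite /density_measure integral_mkcond.
apply: eq_integral => x _; rewrite patchE indicE.
by case: ifPn => _; rewrite ?mul1e ?mul0e.
Qed.

End density_measure.

(** * The substitution z = t / x^(1/alpha) *)
Lemma ltr_powR_mono (R : realType) (r x y : R) : 0 < r -> 0 <= x -> 0 <= y ->
  (x `^ r < y `^ r) = (x < y).
Proof.
move=> r0 x0 y0; apply/idP/idP => [|xy].
  by rewrite !ltNge; apply: contra => yx; apply: ge0_ler_powR => //; exact: ltW.
by apply: gt0_ltr_powR.
Qed.

(** The rays ]-oo, b[ are stable under intersection, generate the Borel sets
    and exhaust the line, so they determine a measure that is finite on them. *)
Lemma measure_eq_rays (R : realType)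
    (m1 m2 : {measure set (measurableTypeR R) -> \bar R}) :
    (forall b, m1 `]-oo, b[%classic = m2 `]-oo, b[%classic) ->
    (forall b, (m1 `]-oo, b[%classic < +oo)%E) ->
  forall A : set (measurableTypeR R), measurable A -> m1 A = m2 A.
Proof.
move=> m12 m1oo A mA.
apply: (@measure_unique _ R (measurableTypeR R) (@RGenInftyO.G R)
  (fun n => `]-oo, n%:R[%classic)) => //.
- exact: RGenInftyO.measurableE.
- move=> _ _ [x ->] [y ->]; exists (Num.min x y).
  by apply/seteqP; split => z /=; rewrite !in_itv/= lt_min => /andP.
- by move=> n; exists n%:R.
- rewrite -subTset => x _; exists (Num.trunc `|x|).+1 => //=.
  by rewrite in_itv/= (le_lt_trans (ler_norm x))// truncnS_gt.
- by move=> _ [x ->]; exact: m12.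
Qed.

Section power_substitution.
Context (R : realType) (alpha t : R).
Hypotheses (alpha0 : 0 < alpha) (t0 : 0 < t).
Local Notation mu := (@lebesgue_measure R).
Local Notation p := (alpha^-1).

(** [phi] maps the positive half-line onto itself, decreasingly, and [k] is the
    absolute value of its derivative. *)
Let phi (x : R) : R := t / x `^ p.
Let k (x : R) : R := t / (alpha * x `^ (1 + p)).

Let D : set R := `]0, +oo[%classic.

Let mD : measurable D. Proof. exact: measurable_itv. Qed.

Let mphi : measurable_fun [set: R] phi.
Proof.
rewrite (_ : phi = fun x => t * x `^ (- p)); last first.
  by apply/funext => x; rewrite powRN.
by apply: measurable_funM => //; exact: measurable_powR.
Qed.

Let kE x : k x = p * t * x `^ (- (1 + p)).
Proof. by rewrite /k powRN invfM; ring. Qed.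

Let k_ge0 x : 0 <= k x.
Proof. by rewrite divr_ge0 ?mulr_ge0 ?powR_ge0// ltW. Qed.

Let mk : measurable_fun [set: R] k.
Proof.
rewrite (funext kE); apply: measurable_funM => //; exact: measurable_powR.
Qed.

Let dphi (x : R) : 0 < x -> is_derive x 1 (fun y : R => - phi y) (k x).
Proof.
move=> x0.
have -> : (fun y => - phi y) = (fun y => - t * y `^ (- p)).
  by apply/funext => y; rewrite /phi powRN mulNr.
have -> : k x = - t * (- p * x `^ (- p - 1)).
  by rewrite kE opprD addrC; ring.
by have := is_derive1_powR (- p) x0; exact: is_deriveZ.
Qed.

Let phi_lt (b x : R) : 0 < b -> 0 < x -> (phi x < b) = ((t / b) `^ alpha < x).
Proof.
move=> b0 x0; rewrite /phi ltr_pdivrMr ?powR_gt0// mulrC -ltr_pdivrMr//.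
rewrite -{2}(powRr1 (ltW x0)) -(mulVf (lt0r_neq0 alpha0)) powRrM.
by rewrite ltr_powR_mono ?powR_ge0// divr_ge0 ?ltW.
Qed.

Let phi_ge0 x : 0 <= phi x.
Proof. by rewrite divr_ge0 ?powR_ge0 ?ltW. Qed.

Let phi_cvgy : (fun x : R => - phi x) @ +oo --> (0 : R).
Proof.
apply/cvgrPdist_lt => e e0.
near=> x.
have x0 : 0 < x by near: x; exact: nbhs_pinfty_gt.
rewrite sub0r opprK ger0_norm ?phi_ge0// phi_lt//.
Unshelve. all: by end_near. Qed.

(** This integral is the mass that the density [k] gives to the set where
    [phi] is below [b]: since - phi is a primitive of [k] vanishing at infinity,
    it is the value of [phi] at the left end point. *)
Let mass_phi (b : R) : 0 < b ->
  (\int[mu]_(x in `]((t / b) `^ alpha)%R, +oo[) (k x)%:E = b%:E)%E.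
Proof.
move=> b0; set c := (t / b) `^ alpha.
have c0 : 0 < c by rewrite powR_gt0// divr_gt0.
have phic : phi c = b.
  rewrite /phi /c -powRrM mulfV ?gt_eqF// powRr1 ?divr_ge0 ?ltW//.
  by rewrite invf_div mulrC divfK ?gt_eqF.
rewrite integral_itv_obnd_cbnd; last exact/measurable_funTS/measurable_EFinP.
have -> : b%:E = (0%:E - (- phi c)%:E)%E by rewrite phic -EFinB opprK add0r.
apply: (ge0_continuous_FTC2y (F := fun x => - phi x)).
- by move=> x _; exact: k_ge0.
- apply: derivable_within_continuous => x; rewrite in_itv/= andbT => cx.
  rewrite (funext kE); apply: derivableM => //.
  by apply: derivable_powR; rewrite in_itv/= andbT (lt_le_trans c0).
- exact: phi_cvgy.
- by move=> x cx; have [] := dphi (lt_trans c0 cx).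
- apply: cvg_at_right_filter.
  have [/derivable1_diffP/differentiable_continuous dc _] := dphi c0.
  exact: dc.
- move=> x; rewrite in_itv/= andbT => cx.
  by rewrite derive1E; have [_ ->] := dphi (lt_trans c0 cx).
Qed.

(** The image under [phi] of the measure with density [k] on the positive
    half-line is Lebesgue measure on that half-line: both give the ray ]-oo, b[
    the mass max(0, b). *)
Lemma ge0_integration_by_substitution_inverse_power (G : R -> \bar R) :
    measurable_fun [set: R] G -> (forall z, (0 <= G z)%E) ->
  (\int[mu]_(z in `]0%R, +oo[) G z =
   \int[mu]_(x in `]0%R, +oo[)
     (G (t / x `^ alpha^-1)%R * (t / (alpha * x `^ (1 + alpha^-1)))%R%:E))%E.
Proof.
move=> mG G0.
have m1D : measurable_fun [set: R] (\1_D : R -> R) by [].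
have D0 x : 0 <= \1_D x :> R by [].
have mkD : measurable_fun [set: R] (fun x => k x * \1_D x).
  by apply: measurable_funM.
have kD0 x : 0 <= k x * \1_D x by rewrite mulr_ge0.
pose m1 : {measure set (measurableTypeR R) -> \bar R} :=
  density_measure mu m1D D0.
pose m2' : {measure set (measurableTypeR R) -> \bar R} :=
  density_measure mu mkD kD0.
have mphi' : measurable_fun [set: measurableTypeR R]
  (phi : measurableTypeR R -> measurableTypeR R) by exact: mphi.
pose m2 : {measure set (measurableTypeR R) -> \bar R} :=
  measure_function_pushforward__canonical__measure_function_Measure m2' mphi'.
have m1E b : (m1 `]-oo, b[%classic = (Num.max 0%R b)%:E)%E.
  rewrite /m1/= /density_measure integral_indic//.
  rewrite (_ : D `&` _ = `]0, b[%classic); last first.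
    by apply/seteqP; split => x; rewrite /D/= !in_itv/= andbT => /andP.
  apply: etrans (lebesgue_measure_itv `]0, b[) _.
  by rewrite /= lte_fin sube0 /Num.max; case: ifP.
have m2E b : (m2 `]-oo, b[%classic = (Num.max 0%R b)%:E)%E.
  rewrite /m2/= /pushforward /m2'/= /density_measure.
  have [b0|b0] := leP b 0.
    rewrite (_ : _ @^-1` _ = set0) ?integral_set0//.
    rewrite -subset0 => x /=; rewrite in_itv/= => /lt_le_trans/(_ b0).
    by rewrite ltNge phi_ge0.
  rewrite -mass_phi// integral_mkcond [RHS]integral_mkcond.
  apply: eq_integral => x _; rewrite !patchE indicE.
  have [xD|xD] := boolP (x \in D).
    have x0 : 0 < x by have := set_mem xD; rewrite /D/= in_itv/= andbT.
    rewrite mulr1; congr (if _ then _ else _).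
    apply/idP/idP => /set_mem; rewrite /= in_itv/= ?andbT => h;
      by apply/mem_set; rewrite /= in_itv/= ?andbT ?phi_lt// -phi_lt.
  rewrite mulr0 if_same ifF//; apply: contraNF xD => /set_mem.
  rewrite /= in_itv/= andbT => cx; apply/mem_set; rewrite /D/= in_itv/= andbT.
  exact: le_lt_trans (powR_ge0 _ _) cx.
have m12 A : measurable A -> m1 A = m2 A.
  by move=> mA; apply: measure_eq_rays => // b; rewrite m1E ?m2E// ltry.
(* Integrals over [D] become integrals against the indicator of [D], the form in
   which densities are expressed. *)
have mkcondD (f : R -> \bar R) :
    (\int[mu]_(x in D) f x = \int[mu]_x (f x * (\1_D x)%:E))%E.
  rewrite integral_mkcond; apply: eq_integral => x _.
  by rewrite patchE indicE; case: ifPn => _; rewrite ?mule1 ?mule0.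
rewrite [LHS]mkcondD [RHS]mkcondD.
transitivity (\int[m1]_z G z)%E; first by rewrite ge0_integral_density.
transitivity (\int[m2]_z G z)%E.
  by apply: eq_measure_integral => A mA _; exact: m12.
transitivity (\int[m2']_x (G (phi x)))%E.
  exact: ge0_integral_pushforward.
rewrite ge0_integral_density//.
  by apply: eq_integral => x _; rewrite EFinM muleA.
by apply: measurableT_comp.
Qed.

End power_substitution.

(** * The Laplace transform determines the law *)
Lemma bounded_integrable d (T : measurableType d) (R : realType)
    (P : probability T R) (f : T -> R) (C : R) :
    measurable_fun [set: T] f -> (forall x, `|f x| <= C) ->
  P.-integrable [set: T] (EFin \o f).
Proof.
move=> mf fC; apply: (le_integrable measurableT (g := EFin \o cst C)).
- exact/measurable_EFinP.
- by move=> x _; rewrite /= lee_fin (le_trans (fC x)) ?ler_norm.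
- exact: finite_measure_integrable_cst.
Qed.

Lemma bounded_convergence d (T : measurableType d) (R : realType)
    (P : probability T R) (f_ : nat -> T -> R) (f : T -> R) (C : R) :
    (forall n, measurable_fun [set: T] (f_ n)) ->
    (forall n x, `|f_ n x| <= C) -> (forall x, f_ n x @[n --> \oo] --> f x) ->
  (\int[P]_x (f_ n x)%:E)%E @[n --> \oo] --> (\int[P]_x (f x)%:E)%E.
Proof.
move=> mf fC cvf.
have cvE x : (f_ n x)%:E @[n --> \oo] --> (f x)%:E.
  by apply: cvg_EFin; [exact: nearW | exact: cvf].
have mfE n : measurable_fun [set: T] (fun x => (f_ n x)%:E).
  exact/measurable_EFinP.
have [] // := @dominated_convergence _ T R P _ measurableT
  (fun n x => (f_ n x)%:E) (fun x => (f x)%:E) (EFin \o cst C).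
- by apply: emeasurable_fun_cvg mfE _ => x _; exact: cvE.
- by apply: aeW => x _; exact: cvE.
- exact: finite_measure_integrable_cst.
- by apply: aeW => x n _; rewrite /= lee_fin.
Qed.

Section laplace_transform.
Context d (T : measurableType d) (R : realType) (P : probability T R).
Local Open Scope ereal_scope.

Definition laplace (X : T -> R) (s : R) : \bar R :=
  \int[P]_w (expR (- (s * X w)))%:E.

Variable X : T -> R.
Hypotheses (mX : measurable_fun [set: T] X) (X0 : forall w, (0 <= X w)%R).

Let mexp (s : R) : measurable_fun [set: T] (fun w => expR (- (s * X w))).
Proof. by do 2 apply: measurableT_comp => //; exact: measurable_funM. Qed.

Let exp_bound (s : R) w : (0 <= s)%R -> (`|expR (- (s * X w))| <= 1)%R.
Proof.
by move=> s0; rewrite ger0_norm ?expR_ge0// -expR0 ler_expR oppr_le0 mulr_ge0.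
Qed.

(** Expanding the outer exponential turns the integrand into a series of the
    functions exp(- k s X), dominated by exp(|c|). *)
Lemma cvg_laplace_double_exponential (c s : R) : (0 <= s)%R ->
  \sum_(k < n) ((exp_coeff c k)%:E * laplace X (k%:R * s)) @[n --> \oo] -->
  \int[P]_w (expR (c * expR (- (s * X w))))%:E.
Proof.
move=> s0; pose U w := expR (- (s * X w)).
have UX k w : (U w ^+ k = expR (- (k%:R * s * X w)))%R.
  by rewrite /U -expRM_natl mulrN mulrA.
have mU : measurable_fun [set: T] U by exact: mexp.
have U0 w : (0 <= U w)%R by exact: expR_ge0.
have U1 w : (U w <= 1)%R by rewrite -(ger0_norm (U0 w)); exact: exp_bound.
have coefE w k : (exp_coeff (c * U w) k = exp_coeff c k * U w ^+ k)%R.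
  by rewrite /exp_coeff/= exprMn mulrAC.
rewrite (_ : (fun n => _) =
    fun n => \int[P]_w (series (exp_coeff (c * U w)%R) n)%:E); last first.
  apply/funext => n; transitivity
      (\sum_(k < n) \int[P]_w ((exp_coeff c k)%:E * (U w ^+ k)%:E)).
    apply: eq_bigr => k _; rewrite integralZl//.
      by congr (_ * _); apply: eq_integral => w _; rewrite UX.
    apply: (@bounded_integrable _ _ _ _ _ 1); first exact: measurable_funX.
    by move=> w; rewrite ger0_norm ?exprn_ge0// exprn_ile1.
  rewrite -integral_sum//; last first.
    move=> k; apply: (integrableZl measurableT).
    apply: (@bounded_integrable _ _ _ _ _ 1); first exact: measurable_funX.
    by move=> w; rewrite ger0_norm ?exprn_ge0// exprn_ile1.
  apply: eq_integral => w _; rewrite seriesEord -sumEFin.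
  by apply: eq_bigr => k _; rewrite coefE EFinM.
apply: (@bounded_convergence _ _ _ _ _ _ (expR `|c|)).
- move=> n; rewrite (_ : (fun w => _) =
      fun w => (\sum_(k < n) exp_coeff c k * U w ^+ k)%R); last first.
    by apply/funext => w; rewrite seriesEord; apply: eq_bigr => k _.
  apply: measurable_sum => k; apply: measurable_funM => //.
  exact: measurable_funX.
- move=> n w; apply: (@le_trans _ _ (series (exp_coeff `|c|) n)).
    rewrite !seriesEord (le_trans (ler_norm_sum _ _ _))// ler_sum// => k _.
    rewrite coefE normrM (ger0_norm (exprn_ge0 _ (U0 w))).
    rewrite (_ : `|exp_coeff c k|%R = exp_coeff `|c| k); last first.
      by rewrite /exp_coeff/= normrM normrX normfV normr_nat.
    by rewrite ler_piMr ?exp_coeff_ge0 ?exprn_ile1.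
  apply: nondecreasing_cvgn_le; last exact: is_cvg_series_exp_coeff.
  by apply: nondecreasing_series => k _ _; exact: exp_coeff_ge0.
- by move=> w; exact: is_cvg_series_exp_coeff.
Qed.

(** The integrand is exp(- n e^(n (a - X))). It tends to 1 where X > a, because
    n e^(- n delta) tends to 0. Where X <= a it is at most exp(- n); the factor
    n in front of the exponential is what sends the atom X = a to 0. *)
Lemma cvg_double_exponential_tail (a : R) :
  \int[P]_w (expR (- (n%:R * expR (n%:R * a)) * expR (- (n%:R * X w))))%:E
    @[n --> \oo] --> P [set w | (a < X w)%R].
Proof.
have mA : measurable [set w | (a < X w)%R].
  rewrite (_ : mkset _ = X @^-1` `]a, +oo[).
    by rewrite -[X in measurable X]setTI; exact: mX.
  by apply/seteqP; split => w /=; rewrite in_itv/= andbT.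
rewrite -[P _](_ : \int[P]_w (\1_[set w | (a < X w)%R] w)%:E = _); last first.
  by rewrite integral_indic// setIT.
apply: (@bounded_convergence _ _ _ _ _ _ (1)).
- move=> n; apply: measurableT_comp => //.
  by apply: measurable_funM => //; exact: mexp.
- by move=> n w; rewrite ger0_norm ?expR_ge0.
move=> w; rewrite indicE.
rewrite (_ : (fun n => _) =
    (fun n => expR (- (n%:R * expR (n%:R * (a - X w))))%R)); last first.
  by apply/funext => n; rewrite mulNr -mulrA -expRD mulrBr.
have [aX|Xa] := ltP a (X w).
  suff h0 : (fun n => - (n%:R * expR (n%:R * (a - X w))))%R @ \oo --> (0 : R)%R.
    rewrite mem_set//= -[X in _ --> X]expR0.
    by apply: (cvg_comp _ _ h0); exact: continuous_expR.
  rewrite -oppr0; apply: cvgN.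
  pose dl := (X w - a)%R.
  have dl0 : (0 < dl)%R by rewrite subr_gt0.
  have -> : (0 = 4 / dl ^+ 2 * 0 :> R)%R by rewrite mulr0.
  apply: (@squeeze_cvgr _ _ _ _ (cst (4 / dl ^+ 2 * 0)%R)
    (fun n => 4 / dl ^+ 2 * harmonic n)%R).
  - apply: nearW => n; rewrite /cst mulr0 mulr_ge0 ?expR_ge0//=.
    have -> : (n%:R * (a - X w) = - (n%:R * dl))%R by rewrite -mulrN opprB.
    (* From e^y >= 1 + y^2 / 2 at y = n dl, and n (n + 1) <= 2 n^2. *)
    rewrite expRN ler_pdivrMr ?expR_gt0// /harmonic/=.
    have dlN0 : (dl != 0)%R by rewrite gt_eqF.
    rewrite (_ : 4 / dl ^+ 2 * n.+1%:R^-1 * expR (n%:R * dl) =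
        4 * expR (n%:R * dl) / (dl ^+ 2 * n.+1%:R))%R; last first.
      by field; rewrite dlN0 andbT.
    rewrite ler_pdivlMr ?mulr_gt0 ?exprn_gt0//.
    have := @expR_ge1Dxn R (n%:R * dl) 1 (mulr_ge0 (ler0n _ _) (ltW dl0)).
    have : (n%:R <= n%:R ^+ 2 :> R)%R.
      by rewrite -natrX ler_nat; case: n => // n; rewrite expnS leq_pmulr.
    rewrite -subr_ge0 -natr1 => /mulr_ge0/(_ (sqr_ge0 dl)).
    by rewrite exprMn (_ : 2`! = 2)%N//; lra.
  - exact: cvg_cst.
  - by apply: cvgMr; exact: cvg_harmonic.
rewrite memNset/=; last by apply/negP; rewrite -leNgt.
apply: (@squeeze_cvgr _ _ _ _ (cst 0%R) (fun n => expR (- n%:R))).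
- apply: nearW => n; rewrite expR_ge0/= ler_expR lerN2 ler_peMr//.
  by rewrite -expR0 ler_expR mulr_ge0// subr_ge0.
- exact: cvg_cst.
- exact: cvgn_expR.
Qed.

End laplace_transform.

(** The double-exponential integrals are limits of combinations of values of the
    Laplace transform, and the tails are limits of these integrals. *)
Lemma laplace_inj_tail d1 d2 (T1 : measurableType d1) (T2 : measurableType d2)
    (R : realType) (P1 : probability T1 R) (P2 : probability T2 R)
    (X1 : T1 -> R) (X2 : T2 -> R) :
    measurable_fun [set: T1] X1 -> (forall w, 0 <= X1 w) ->
    measurable_fun [set: T2] X2 -> (forall w, 0 <= X2 w) ->
    (forall s, 0 <= s -> laplace P1 X1 s = laplace P2 X2 s) ->
  forall a, P1 [set w | a < X1 w] = P2 [set w | a < X2 w].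
Proof.
move=> mX1 X10 mX2 X20 L12 a.
have := cvg_double_exponential_tail (P := P1) (a := a) mX1.
rewrite (_ : (fun n => _) = (fun n => \int[P2]_w
  (expR (- (n%:R * expR (n%:R * a)) * expR (- (n%:R * X2 w))))%:E)%E).
  move=> /cvg_unique; apply => //.
  exact: cvg_double_exponential_tail.
apply/funext => n.
set c := - (n%:R * _).
have := cvg_laplace_double_exponential (P := P1) (c := c) mX1 X10 (ler0n R n).
under eq_fun => m do under eq_bigr => k _ do
  rewrite (L12 _ (mulr_ge0 (ler0n _ _) (ler0n _ _))).
move=> /cvg_unique; apply => //.
exact: cvg_laplace_double_exponential.
Qed.

(** * The law of the inverse stable subordinator *)
Lemma ge0_integral_has_density d (T : measurableType d) (R : realType)
    (P : probability T R) (Z : T -> R) (g : R -> R) (f : R -> \bar R) :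
    measurable_fun [set: T] Z -> has_density P Z g ->
    measurable_fun [set: R] f -> (forall x, (0 <= f x)%E) ->
  (\int[P]_w f (Z w) = \int[lebesgue_measure]_x (f x * (g x)%:E))%E.
Proof.
move=> mZ [mg g0 PZ] mf f0.
have mZ' : measurable_fun [set: T] (Z : T -> measurableTypeR R) by exact: mZ.
have mg' : measurable_fun [set: measurableTypeR R] g by exact: mg.
pose m1 : {measure set (measurableTypeR R) -> \bar R} :=
  measure_function_pushforward__canonical__measure_function_Measure P mZ'.
pose m2 : {measure set (measurableTypeR R) -> \bar R} :=
  density_measure lebesgue_measure mg' g0.
transitivity (\int[m1]_x f x)%E; first by rewrite /m1 ge0_integral_pushforward.
transitivity (\int[m2]_x f x)%E; last exact: ge0_integral_density.
by apply: eq_measure_integral => A mA _; exact: PZ.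
Qed.

Lemma ge0_eq_integral_law d (T : measurableType d) (R : realType)
    (P : probability T R) (Z1 Z2 : T -> R) (f : R -> \bar R) :
    measurable_fun [set: T] Z1 -> measurable_fun [set: T] Z2 ->
    (forall b, P [set w | Z1 w < b] = P [set w | Z2 w < b]) ->
    measurable_fun [set: R] f -> (forall x, (0 <= f x)%E) ->
  (\int[P]_w f (Z1 w) = \int[P]_w f (Z2 w))%E.
Proof.
move=> mZ1 mZ2 PZ mf f0.
have mZ1' : measurable_fun [set: T] (Z1 : T -> measurableTypeR R) by exact: mZ1.
have mZ2' : measurable_fun [set: T] (Z2 : T -> measurableTypeR R) by exact: mZ2.
pose m1 : {measure set (measurableTypeR R) -> \bar R} :=
  measure_function_pushforward__canonical__measure_function_Measure P mZ1'.
pose m2 : {measure set (measurableTypeR R) -> \bar R} :=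
  measure_function_pushforward__canonical__measure_function_Measure P mZ2'.
transitivity (\int[m1]_x f x)%E; first by rewrite /m1 ge0_integral_pushforward.
transitivity (\int[m2]_x f x)%E; last by rewrite /m2 ge0_integral_pushforward.
apply: eq_measure_integral => A mA _.
apply: measure_eq_rays mA => [|b]; first exact: PZ.
apply: le_lt_trans (ltry 1); apply: probability_le1.
by rewrite -[X in measurable X]setTI; exact: mZ1.
Qed.

Section inverse_stable_law.
Context d (T : measurableType d) (R : realType) (P : probability T R).
Variables (alpha : R) (L : R -> T -> R) (g : R -> R) (t : R).
Hypotheses (alpha0 : 0 < alpha) (stableL : stable_subordinator P alpha L)
  (densL : has_density P (L 1) g) (t0 : 0 < t).
Local Notation p := (alpha^-1).
Local Notation Y := (inverse_process L t).

Let mL x : 0 <= x -> measurable_fun [set: T] (L x).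
Proof. by move: stableL => [[[mL _ _ _] _ _] _]; exact: mL. Qed.

Let L0 w : L 0 w = 0.
Proof. by move: stableL => [[[_ L0 _ _] _ _] _]. Qed.

Let ndL w x y : 0 <= x -> x <= y -> L x w <= L y w.
Proof. by move: stableL => [[[_ _ ndL _] _ _] _]; exact: ndL. Qed.

Let L_ge0 w x : 0 <= x -> 0 <= L x w.
Proof. by move=> x0; rewrite -(L0 w) ndL. Qed.

Let hit_set w := [set u | 0 <= u /\ t < L u w].

Lemma inverse_process_ge0 w : 0 <= Y w.
Proof.
rewrite /inverse_process -/(hit_set w).
have [->|/set0P S0] := eqVneq (hit_set w) set0.
  by rewrite inf0.
by apply: lb_le_inf => // u [].
Qed.

(** The event that the level [t] is never exceeded; it turns out to be null. *)
Let never := \bigcap_n [set w | L n%:R w <= t].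

(** A sequence in [0, b[ increasing to [b]. *)
Let grid (b : R) (n : nat) := b * (1 - n.+1%:R^-1).

Let grid_ge0 b n : 0 < b -> 0 <= grid b n.
Proof.
by move=> b0; rewrite mulr_ge0 ?(ltW b0)// subr_ge0 invf_le1 ?ltr0n// ler1n.
Qed.

Let grid_lt b n : 0 < b -> grid b n < b.
Proof. by move=> b0; rewrite gtr_pMr// ltrBlDr ltrDl invr_gt0 ltr0n. Qed.

Let grid_nd b m n : 0 < b -> (m <= n)%N -> grid b m <= grid b n.
Proof.
by move=> b0 mn; rewrite ler_pM2l// lerB// lef_pV2 ?posrE ?ltr0n// ler_nat ltnS.
Qed.

Let grid_sup b u : 0 < b -> u < b -> exists n, u <= grid b n.
Proof.
move=> b0 ub; exists (Num.trunc (b / (b - u))).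
have bu : 0 < b - u by rewrite subr_gt0.
have := truncnS_gt (b / (b - u)); set n := (X in X%:R) => hn.
have n0 : 0 < n%:R :> R by rewrite ltr0n.
rewrite /grid -/n mulrBr mulr1 lerBrDr -lerBrDl ler_pdivrMr//.
by rewrite mulrC -ler_pdivrMr// ltW.
Qed.

(** The first passage strictly before [b] is seen along any sequence increasing
    to [b], because [L] is nondecreasing. On the event [never] the infimum is
    the default value [0]. *)
Let inverse_process_lt b : 0 < b ->
  [set w | Y w < b] = (\bigcup_n [set w | t < L (grid b n) w]) `|` never.
Proof.
move=> b0; apply/seteqP; split => w /=.
  have [S0 _|/set0P S0] := eqVneq (hit_set w) set0.
    right => n _ /=; rewrite leNgt; apply/negP => tL.
    by have : hit_set w n%:R by []; rewrite S0.
  move=> /(inf_lt S0)[u [u0 tLu] ub]; left.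
  have [n un] := grid_sup b0 ub; exists n => //=.
  by apply: lt_le_trans tLu _; exact: ndL.
move=> [[n _ /= tL]|nev].
  apply: le_lt_trans (grid_lt n b0).
  by apply: ge_inf; [exists 0 => u []|split => //; exact: grid_ge0].
rewrite /inverse_process -/(hit_set w) (_ : hit_set w = set0) ?inf0//.
rewrite -subset0 => u [u0 tLu].
have := nev (Num.trunc u).+1 I; rewrite /= leNgt => /negP; apply.
by apply: lt_le_trans tLu _; apply: ndL => //; exact/ltW/truncnS_gt.
Qed.

Let mgt x : 0 <= x -> measurable [set w | t < L x w].
Proof.
move=> x0; rewrite (_ : mkset _ = L x @^-1` `]t, +oo[%classic).
  by rewrite -[X in measurable X]setTI; exact: mL.
by apply/seteqP; split => w /=; rewrite in_itv/= andbT.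
Qed.

Let neverC : never = ~` \bigcup_n [set w | t < L n%:R w].
Proof.
rewrite setC_bigcup; apply: eq_bigcapr => n _.
apply/seteqP; split => w /=; first by rewrite leNgt => /negP.
by move/negP; rewrite -leNgt.
Qed.

Let mnever : measurable never.
Proof.
rewrite neverC; apply: measurableC; apply: bigcupT_measurable => n.
exact: mgt.
Qed.

Let mY_lt b : measurable [set w | Y w < b].
Proof.
have [b0|b0] := leP b 0.
  rewrite (_ : mkset _ = set0)// -subset0 => w /= /lt_le_trans/(_ b0).
  by rewrite ltNge inverse_process_ge0.
rewrite inverse_process_lt//; apply: measurableU => //.
by apply: bigcupT_measurable => n; exact/mgt/grid_ge0.
Qed.

Lemma measurable_inverse_process : measurable_fun [set: T] Y.
Proof.
move=> _; apply: (measurability _ (RGenInftyO.measurableE R)) => //.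
by move=> _ [_ [b ->] <-]; rewrite setTI; exact: mY_lt.
Qed.

(** (t / z)^alpha, with the power distributed over the quotient so that [psi] is
    a product of measurable power functions on the whole line. *)
Let psi (z : R) : R := t `^ alpha * z `^ (- alpha).

Let W w := psi (L 1 w).

Let psi_ge0 z : 0 <= psi z.
Proof. by rewrite mulr_ge0 ?powR_ge0. Qed.

Let mpsi : measurable_fun [set: R] psi.
Proof. by apply: measurable_funM => //; exact: measurable_powR. Qed.

Let mW : measurable_fun [set: T] W.
Proof. by apply: measurableT_comp => //; exact: mL. Qed.

Let psi_lt z x : 0 < z -> 0 < x -> (psi z < x) = (t < x `^ p * z).
Proof.
move=> z0 x0; rewrite /psi powRN ltr_pdivrMr ?powR_gt0//.
rewrite -{1}(powRr1 (ltW x0)) -{1}(mulVf (lt0r_neq0 alpha0)) powRrM.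
by rewrite -powRM ?powR_ge0 ?ltW// ltr_powR_mono ?mulr_ge0 ?powR_ge0 ?ltW.
Qed.

Let psiK x : 0 < x -> psi (t / x `^ p) = x.
Proof.
move=> x0; rewrite /psi powRN powRM ?invr_ge0 ?powR_ge0 ?ltW//.
rewrite -powRN -powRrM mulNr mulVf ?gt_eqF// powRN powRr1 ?ltW//.
by rewrite invfM invrK mulrA mulfV ?mul1r// gt_eqF// powR_gt0.
Qed.

Let L1_le0_null : P [set w | L 1 w <= 0] = 0%E.
Proof.
have [mg g0 PL] := densL.
rewrite (_ : mkset _ = L 1 @^-1` [set 0]); last first.
  apply/seteqP; split => w /=; last by move=> ->.
  by move=> L1; apply/eqP; rewrite eq_le L1 L_ge0.
by rewrite PL// integral_set1.
Qed.

Let mL1_le0 : measurable [set w | L 1 w <= 0].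
Proof.
rewrite (_ : mkset _ = L 1 @^-1` `]-oo, 0]%classic).
  by rewrite -[X in measurable X]setTI; exact: mL.
by apply/seteqP; split => w /=; rewrite in_itv.
Qed.

Let mW_lt b : measurable [set w | W w < b].
Proof.
rewrite (_ : mkset _ = W @^-1` `]-oo, b[%classic).
  by rewrite -[X in measurable X]setTI; exact: mW.
by apply/seteqP; split => w /=; rewrite in_itv.
Qed.

Let laplace_stable x s : 0 <= s -> 0 <= x ->
  laplace P (L x) s = (expR (- (x * s `^ alpha)))%:E.
Proof.
by move=> s0 x0; move: stableL => [_ <-//]; rewrite unlock.
Qed.

(** By self-similarity, [L x] and [x `^ alpha^-1 * L 1] have the same Laplace
    transform, hence the same tails; and where [L 1] is positive, the tail event
    of the latter is a lower ray for [W]. *)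
Let stable_tail x : 0 <= x -> P [set w | t < L x w] = P [set w | W w < x].
Proof.
rewrite le_eqVlt => /predU1P[<-|x0].
  congr (P _); apply/seteqP; split => w /=; last by rewrite ltNge psi_ge0.
  by rewrite L0 ltNge ltW.
transitivity (P [set w | t < x `^ p * L 1 w]).
  apply: (laplace_inj_tail (X1 := L x) (X2 := fun w => x `^ p * L 1 w)).
  - exact/mL/ltW.
  - by move=> w; exact/L_ge0/ltW.
  - by apply: measurable_funM => //; exact: mL.
  - by move=> w; rewrite mulr_ge0 ?powR_ge0 ?L_ge0.
  move=> s s0; transitivity (laplace P (L 1) (s * x `^ p)).
    have sx0 : 0 <= s * x `^ p by rewrite mulr_ge0 ?powR_ge0.
    rewrite (laplace_stable s0 (ltW x0)) (laplace_stable sx0 ler01).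
    congr (expR (- _))%:E.
    rewrite mul1r (powRM _ s0 (powR_ge0 x p)) -powRrM.
    by rewrite (mulVf (lt0r_neq0 alpha0)) (powRr1 (ltW x0)) mulrC.
  by rewrite /laplace; apply: eq_integral => w _; rewrite mulrA.
(* Both events are enlarged by the null event [L 1 <= 0], where the default
   value of the inverse makes [psi] meaningless. *)
rewrite -[RHS](measureU0 _ mL1_le0 L1_le0_null)//.
rewrite -[LHS](measureU0 _ mL1_le0 L1_le0_null)//; last first.
  rewrite (_ : mkset _ = (fun w => x `^ p * L 1 w) @^-1` `]t, +oo[%classic).
    rewrite -[X in measurable X]setTI; apply: measurable_funM => //.
    exact: mL.
  by apply/seteqP; split => w /=; rewrite in_itv/= andbT.
congr (P _); apply/seteqP; split => w /=;
  have [L1|L1] := leP (L 1 w) 0; try by right.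
  by move=> [tL|]//; left; rewrite /W psi_lt.
by move=> [tL|]//; left; rewrite -psi_lt.
Qed.

Let stable_tail_bigcup (x : nat -> R) :
    (forall n, 0 <= x n) -> {homo x : m n / (m <= n)%N >-> m <= n} ->
  P (\bigcup_n [set w | t < L (x n) w]) = P (\bigcup_n [set w | W w < x n]).
Proof.
move=> x0 ndx.
have mL_ n : measurable [set w | t < L (x n) w] by exact: mgt.
have cvL : (fun n => P [set w | t < L (x n) w]) @ \oo -->
    P (\bigcup_n [set w | t < L (x n) w]).
  apply: nondecreasing_cvg_mu => //; first exact: bigcupT_measurable.
  move=> m n mn; apply/subsetPset => w /= tL.
  by apply: lt_le_trans tL _; apply: ndL => //; exact: ndx.
have cvW : (fun n => P [set w | W w < x n]) @ \oo -->
    P (\bigcup_n [set w | W w < x n]).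
  apply: nondecreasing_cvg_mu.
  - by move=> n; exact: mW_lt.
  - by apply: bigcupT_measurable => n; exact: mW_lt.
  move=> m n mn; apply/subsetPset => w /= Wx.
  by apply: lt_le_trans Wx _; exact: ndx.
have LW : (fun n => P [set w | t < L (x n) w]) = (fun n => P [set w | W w < x n]).
  by apply/funext => n; rewrite stable_tail.
by rewrite LW in cvL; exact: cvg_unique cvL cvW.
Qed.

(** Its complement has the probability of the union of the events [W < n]. *)
Let never_null : P never = 0%E.
Proof.
rewrite neverC probability_setC; last first.
  by apply: bigcupT_measurable => n; exact: mgt.
have -> : P (\bigcup_n [set w | t < L n%:R w]) = 1%E.
  transitivity (P (\bigcup_n [set w | W w < n%:R])).
    by apply: stable_tail_bigcup => // m n; rewrite ler_nat.
  rewrite (_ : \bigcup_n _ = setT) ?probability_setT//.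
  rewrite -subTset => w _; exists (Num.trunc (W w)).+1 => //=.
  exact: truncnS_gt.
by rewrite subee.
Qed.

(** Up to the null event [never], [Y < b] and [W < b] are increasing unions,
    along the same sequence of times, of events with equal probabilities. *)
Let inverse_process_law b : P [set w | Y w < b] = P [set w | W w < b].
Proof.
have [b0|b0] := leP b 0.
  congr (P _); apply/seteqP; split => w /= /lt_le_trans/(_ b0).
    by rewrite ltNge inverse_process_ge0.
  by rewrite ltNge psi_ge0.
rewrite inverse_process_lt// measureU0//; last first.
  by apply: bigcupT_measurable => n; exact/mgt/grid_ge0.
transitivity (P (\bigcup_n [set w | W w < grid b n])).
  apply: stable_tail_bigcup => [n|m n]; [exact: grid_ge0|exact: grid_nd].
congr (P _); apply/seteqP; split => w /=.
  by move=> [n _ /= Wb]; exact: lt_trans Wb (grid_lt n b0).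
move=> Wb; have [n Wn] := grid_sup b0 (midf_lt Wb).2.
by exists n => //=; exact: lt_le_trans (midf_lt Wb).1 Wn.
Qed.

(** [Y] is replaced by [W = psi (L 1)], then the density of [L 1] is used on the
    positive half-line, where the substitution inverts [psi]. *)
Lemma ge0_integral_inverse_process (f : R -> \bar R) :
    measurable_fun [set: R] f -> (forall x, (0 <= f x)%E) ->
  (\int[P]_w f (Y w) = \int[lebesgue_measure]_(x in `]0%R, +oo[)
     (f x * (inverse_stable_density alpha g t x)%:E))%E.
Proof.
move=> mf f0.
rewrite (ge0_eq_integral_law measurable_inverse_process mW inverse_process_law)//.
pose D : set R := `]0, +oo[%classic.
have [mg g0 _] := densL.
have mD1 : measurable_fun [set: R] (\1_D : R -> R).
  by apply: measurable_indic; exact: measurable_itv.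
have mfpsi : measurable_fun [set: R] (f \o psi) by exact: measurableT_comp.
have mfpsig : measurable_fun [set: R] (fun z => f (psi z) * (g z)%:E)%E.
  apply: (emeasurable_funM (f := f \o psi)) => //.
  exact/measurable_EFinP.
have mfpsi1 : measurable_fun [set: R] (fun z => f (psi z) * (\1_D z)%:E)%E.
  apply: (emeasurable_funM (f := f \o psi)) => //.
  exact/measurable_EFinP.
transitivity (\int[P]_w (f (psi (L 1 w)) * (\1_D (L 1 w))%:E))%E.
  apply: ge0_ae_eq_integral => //.
  - exact: measurableT_comp.
  - exact: measurableT_comp mfpsi1 (mL ler01).
  - by move=> w _; rewrite mule_ge0.
  exists [set w | L 1 w <= 0]; split => // w /= neq.
  rewrite leNgt; apply/negP => L1; apply: neq => _.
  by rewrite indicE mem_set ?mule1// /D/= in_itv/= L1.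
rewrite (@ge0_integral_has_density _ _ _ P (L 1) g
  (fun z => f (psi z) * (\1_D z)%:E)%E)//.
- transitivity (\int[lebesgue_measure]_(z in D) (f (psi z) * (g z)%:E))%E.
    rewrite [RHS]integral_mkcond; apply: eq_integral => z _.
    rewrite patchE indicE; have [zD|zD] := boolP (z \in D).
      by rewrite mule1.
    by rewrite mule0 mul0e.
  have fg0 z : (0 <= f (psi z) * (g z)%:E)%E by rewrite mule_ge0 ?lee_fin.
  apply: etrans (ge0_integration_by_substitution_inverse_power alpha0 t0
    mfpsig fg0) _.
  apply: eq_integral => x /set_mem; rewrite /= in_itv/= andbT => x0.
  by rewrite psiK// /inverse_stable_density EFinM -muleA (muleC (g _)%:E).
- exact: mL.
- by move=> x; rewrite mule_ge0.
Qed.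

End inverse_stable_law.

(** * A process at an independent random time *)
Section independent_random_time.
Context d (T : measurableType d) (R : realType) (P : probability T R).
Variables (X : R -> T -> R) (Z : T -> R).
Hypotheses (incX : increasing_process X) (mZ : measurable_fun [set: T] Z)
  (Z0 : forall w, 0 <= Z w).
Hypothesis indXZ : forall (A : set T) (B : set R),
  process_sigma_algebra X A -> measurable B ->
  (P (A `&` Z @^-1` B) = P A * P (Z @^-1` B))%E.

Let mX x : 0 <= x -> measurable_fun [set: T] (X x).
Proof. by have [+ _ _ _] := incX; apply. Qed.

Let X0 w : X 0 w = 0.
Proof. by have [_ + _ _] := incX; apply. Qed.

Let ndX w x y : 0 <= x -> x <= y -> X x w <= X y w.
Proof. by have [_ _ + _] := incX; apply. Qed.

Let X_ge0 w x : 0 <= x -> 0 <= X x w.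
Proof. by move=> x0; rewrite -(X0 w) ndX. Qed.

Let G : set (set T) := [set A | exists (t : R) (B : set R),
  [/\ 0 <= t, measurable B & A = X t @^-1` B]].

(** The path of [X] is modelled by the sample space itself with the sigma-algebra
    generated by [X]; its law is the image of [P] under the identity. *)
Local Notation S := (g_sigma_algebraType G).

Let sub_sigma (A : set T) : measurable (A : set S) -> measurable A.
Proof.
apply: smallest_sub; first exact: sigma_algebra_measurable.
move=> _ [t [B [t0 mB ->]]].
by rewrite -[X in measurable X]setTI; exact: mX.
Qed.

Let toS (w : T) : S := w.

Let mtoS : measurable_fun [set: T] toS.
Proof. by move=> _ A mA; rewrite setTI; exact: sub_sigma. Qed.

Let RV_S : {mfun T >-> S} := HB.pack toS (isMeasurableFun.Build _ _ _ _ _ mtoS).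
Let RV_Z : {mfun T >-> R} := HB.pack Z (isMeasurableFun.Build _ _ _ _ _ mZ).

Let joint (w : T) : R * S := (Z w, w).

Let mjoint : measurable_fun [set: T] joint.
Proof. by apply: measurable_fun_pair => //; exact: mtoS. Qed.

(** [X] is only controlled at nonnegative times, so time is truncated at 0. *)
Let F (z : R * S) : \bar R := (X (Num.max 0 z.1) z.2)%:E.

Let mXS q : 0 <= q -> measurable_fun [set: S] (X q : S -> R).
Proof.
move=> q0 _ B mB; rewrite setTI; apply: sub_sigma_algebra.
by exists q, B.
Qed.

(** A strict upper bound on a right-continuous nondecreasing path at time x is
    the same bound at some rational time after x. *)
Let F_lt r : [set z : R * S | X (Num.max 0 z.1) z.2 < r] =
  \bigcup_(q : rat) ([set x | Num.max 0 x < ratr q] `*`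
                     [set w : S | X (Num.max 0 (ratr q)) w < r]).
Proof.
apply/seteqP; split => [[x w]/= Xr|[x w] [q _ /= [xq Xq]]]; last first.
  apply: le_lt_trans Xq; apply: ndX; first by rewrite le_max lexx.
  by rewrite le_max (ltW xq) orbT.
have x0 : 0 <= Num.max 0 x by rewrite le_max lexx.
have [_ _ _ rcX] := incX.
have : \forall u \near (Num.max 0 x)^'+, X u w < r.
  by have /cvgr_lt := rcX w _ x0; apply.
move=> [e /= e0 He].
have /rat_in_itvoo[q] : Num.max 0 x < Num.max 0 x + e by rewrite ltrDl.
rewrite in_itv/= => /andP[xq qe]; exists q => //=.
have q0 : 0 <= ratr q :> R by rewrite (le_trans x0)// ltW.
split => //; rewrite max_r//; apply: He => //=.
by rewrite distrC ger0_norm ?subr_ge0 1?ltW// ltrBlDl.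
Qed.

Let mF : measurable_fun [set: R * S] F.
Proof.
apply/measurable_EFinP => _.
apply: (measurability _ (RGenInftyO.measurableE R)) => //.
move=> _ [_ [r ->] <-]; rewrite setTI.
rewrite (_ : _ @^-1` _ =
    [set z : R * S | X (Num.max 0 z.1) z.2 < r]); last first.
  by apply/seteqP; split => z /=; rewrite in_itv.
rewrite F_lt; apply: bigcupT_measurable_rat => q; apply: measurableX.
  rewrite (_ : mkset _ = (Num.max 0 : R -> R) @^-1` `]-oo, ratr q[%classic).
    rewrite -[X in measurable X]setTI; apply: measurable_maxr => //.
  by apply/seteqP; split => z /=; rewrite in_itv.
rewrite (_ : mkset _ = (X (Num.max 0 (ratr q)) : S -> R) @^-1` `]-oo, r[%classic).
  rewrite -[X in measurable X]setTI; apply: mXS => //.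
  by rewrite le_max lexx.
by apply/seteqP; split => z /=; rewrite in_itv.
Qed.

(** By independence, the pair of [Z] and the path of [X] has a product law;
    Tonelli's theorem then allows integrating over the path at a fixed time. *)
Lemma ge0_integral_independent_time :
  (\int[P]_w (X (Z w) w)%:E = \int[P]_w (\int[P]_w' (X (Z w) w')%:E))%E.
Proof.
pose mj : {measure set (R * S) -> \bar R} :=
  measure_function_pushforward__canonical__measure_function_Measure P mjoint.
pose PZ := distribution P RV_Z.
pose PS := distribution P RV_S.
have jointE A : measurable A -> (PZ \x PS)%E A = mj A.
  apply: product_measure_unique => B C mB mC.
  rewrite /mj/= /pushforward /PZ /PS /distribution /pushforward/= muleC.
  rewrite -indXZ//; congr (P _).
  by apply/seteqP; split => w /= [].
have F0 z : (0 <= F z)%E by rewrite lee_fin X_ge0// le_max lexx.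
have maxZ w : Num.max 0 (Z w) = Z w by rewrite max_r.
transitivity (\int[mj]_z F z)%E.
  rewrite /mj ge0_integral_pushforward//.
  by apply: eq_integral => w _; rewrite /F/= maxZ.
transitivity (\int[(PZ \x PS)%E]_z F z)%E.
  by apply: eq_measure_integral => A mA _; apply/esym; exact: jointE.
rewrite fubini_tonelli1//.
rewrite ge0_integral_distribution//; last 2 first.
- exact: measurable_fun_fubini_tonelli_F.
- by move=> y; apply: integral_ge0.
apply: eq_integral => w _; rewrite /= /fubini_F.
rewrite ge0_integral_distribution//.
  by apply: eq_integral => w' _; rewrite /F/= maxZ.
exact: measurableT_comp.
Qed.

End independent_random_time.

(** * The nonhomogeneous Poisson process *)
Section cumulative_intensity.
Context (R : realType) (lambda : R -> R).
Hypothesis intl : intensity lambda.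
Local Notation mu := (@lebesgue_measure R).
Local Notation Lambda := (cumulative_intensity lambda).

Let lambda_ge0 u : 0 <= u -> 0 <= lambda u.
Proof. by have [+ _] := intl; apply. Qed.

Let lambda_int t : mu.-integrable `[0, t] (EFin \o lambda).
Proof.
have [t0|t0] := leP 0 t; first by have [_ +] := intl; exact.
by rewrite set_itv_ge ?bnd_simp -?ltNge//; exact: integrable_set0.
Qed.

Lemma cumulative_intensityE t :
  (Lambda t)%:E = (\int[mu]_(u in `[0%R, t]) (lambda u)%:E)%E.
Proof. by rewrite fineK//; apply: integrable_fin_num. Qed.

Lemma cumulative_intensity_nondecreasing x y : x <= y -> Lambda x <= Lambda y.
Proof.
move=> xy; rewrite -lee_fin !cumulative_intensityE.
apply: ge0_subset_integral => //.
- by have /integrableP[] := lambda_int y.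
- by move=> u; rewrite /= in_itv/= => /andP[u0 _]; rewrite lee_fin lambda_ge0.
- by apply: subset_itvl; rewrite bnd_simp.
Qed.

Lemma cumulative_intensity0 : Lambda 0 = 0.
Proof. by rewrite /cumulative_intensity set_itv1 Rintegral_set1. Qed.

Lemma cumulative_intensity_ge0 t : 0 <= Lambda t.
Proof.
rewrite -lee_fin cumulative_intensityE; apply: integral_ge0 => u.
by rewrite /= in_itv/= => /andP[u0 _]; rewrite lee_fin lambda_ge0.
Qed.

Lemma measurable_cumulative_intensity : measurable_fun [set: R] Lambda.
Proof.
apply: nondecreasing_measurable => // x y.
exact: cumulative_intensity_nondecreasing.
Qed.

Lemma cumulative_intensity_right_continuous t : 0 <= t ->
  Lambda u @[u --> t^'+] --> Lambda t.
Proof.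
move=> t0.
have t1 : 0 <= t + 1 by rewrite addr_ge0.
have := parameterized_integral_continuous t1 (lambda_int (t + 1)).
have t1' : 0 < t + 1 by rewrite ltr_wpDl.
move=> /(continuous_within_itvP _ t1')[cint cr _].
move: t0; rewrite le_eqVlt => /predU1P[<-|t0]; first exact: cr.
apply: cvg_at_right_filter; apply: cint.
by rewrite in_itv/= t0 ltrDl ltr01.
Qed.

End cumulative_intensity.

(** Right-continuity passes through the time change because [Lambda] is
    nondecreasing and right-continuous: it approaches its value at [t] from the
    right, or is locally constant there. *)
Lemma nonhomogeneous_poisson_increasing d (T : measurableType d) (R : realType)
    (lambda : R -> R) (N1 : R -> T -> nat) :
    intensity lambda -> increasing_process (real_process N1) ->
  increasing_process (real_process (nonhomogeneous_poisson N1 lambda)).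
Proof.
move=> intl [mN N0 ndN rcN]; split.
- by move=> t t0; apply: mN; exact: cumulative_intensity_ge0.
- move=> w; rewrite /real_process /nonhomogeneous_poisson.
  by rewrite cumulative_intensity0//; exact: N0.
- move=> w s t s0 st; apply: ndN; first exact: cumulative_intensity_ge0.
  exact: cumulative_intensity_nondecreasing.
move=> w t t0; rewrite /real_process /nonhomogeneous_poisson.
have La0 := cumulative_intensity_ge0 intl t.
apply/cvgrPdist_lt => e e0.
have /cvgrPdist_lt/(_ e e0)[dl /= dl0 Hdl] := rcN w _ La0.
have /cvgrPdist_lt/(_ dl dl0)[dt /= dt0 Hdt] :=
  cumulative_intensity_right_continuous intl t0.
exists dt => //= u tu_dt tu.
have := cumulative_intensity_nondecreasing intl (ltW tu).
rewrite le_eqVlt => /predU1P[<-|]; first by rewrite subrr normr0.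
by apply: Hdl => /=; exact: Hdt.
Qed.

Lemma poisson_series (R : realType) (s : R) :
  (\sum_(k <oo) (k%:R * (s ^+ k / k`!%:R * expR (- s)))%:E = s%:E)%E.
Proof.
apply/cvg_lim => //.
have partE n : (\sum_(0 <= k < n.+1) (k%:R * (s ^+ k / k`!%:R * expR (- s)))%:E =
    (s * expR (- s) * series (exp_coeff s) n)%:E)%E.
  rewrite big_nat_recl// mul0r add0e sumEFin /series/= mulr_sumr; congr _%:E.
  apply: eq_bigr => k _.
  rewrite /exp_coeff/= factS natrM exprS.
  have k0 : k.+1%:R != 0 :> R by rewrite pnatr_eq0.
  have k1 : k`!%:R != 0 :> R by rewrite pnatr_eq0 -lt0n fact_gt0.
  move: k0 k1; move: (k.+1%:R) (k`!%:R) => a b a0 b0.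
  by field; rewrite a0 b0.
(* The term of index 0 vanishes, so the partial sums are shifted by one. *)
rewrite -cvg_shiftS (funext partE).
have se : s = s * expR (- s) * expR s.
  by rewrite -mulrA expRN mulVf ?mulr1// gt_eqF// expR_gt0.
rewrite [X in _ --> X%:E]se.
apply: cvg_EFin; first exact: nearW.
apply: (@cvgMr _ _ _ _ (series (exp_coeff s)) (s * expR (- s)) (expR s)).
exact: is_cvg_series_exp_coeff.
Qed.

(** The integral is split over the events [N1 s = k]. *)
Lemma poisson_process_mean d (T : measurableType d) (R : realType)
    (P : probability T R) (N1 : R -> T -> nat) (s : R) :
    poisson_process P 1 N1 -> 0 <= s ->
  (\int[P]_w (real_process N1 s w)%:E = s%:E)%E.
Proof.
move=> [[mN N0 _ _] _ PN] s0.
have N10 w : N1 0 w = 0%N.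
  by have /eqP := N0 w; rewrite /real_process pnatr_eq0 => /eqP.
pose F k := [set w | N1 s w = k].
have mF k : measurable (F k).
  rewrite (_ : F k = real_process N1 s @^-1` [set k%:R]).
    by rewrite -[X in measurable X]setTI; exact: mN.
  apply/seteqP; split => w /=; first by rewrite /F/= => <-.
  by rewrite /real_process => /eqP; rewrite eqr_nat => /eqP.
have FT : \bigcup_k F k = setT by rewrite -subTset => w _; exists (N1 s w).
rewrite -FT ge0_integral_bigcup//; last 3 first.
- by rewrite FT; exact/measurable_EFinP/mN.
- by move=> w _; rewrite lee_fin /real_process.
- by move=> i j _ _ [w []]; rewrite /F /= => -> ->.
rewrite -[RHS]poisson_series; apply: eq_eseriesr => k _.
transitivity (\int[P]_(w in F k) (cst k%:R%:E) w)%E.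
  by apply: eq_integral => w /set_mem; rewrite /F /real_process /= => ->.
rewrite integral_cst// EFinM; congr (_ * _)%E.
have := PN 0 s k (lexx _) s0; rewrite subr0 mul1r => <-.
by congr (P _); apply/seteqP; split => w /=; rewrite /F /= N10 add0n.
Qed.

(** * The mean of the time-changed process *)
Lemma poisson_time_change_mean d (T : measurableType d) (R : realType)
    (P : probability T R) (lambda : R -> R) (N1 : R -> T -> nat)
    (Y : R -> T -> R) (t : R)
    (N := nonhomogeneous_poisson N1 lambda) :
    intensity lambda -> poisson_process P 1 N1 ->
    independent_processes P (real_process N) Y ->
    0 <= t -> measurable_fun [set: T] (Y t) -> (forall w, 0 <= Y t w) ->
  (\int[P]_w (N (Y t w) w)%:R%:E =
   \int[P]_w (cumulative_intensity lambda (Y t w))%:E)%E.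
Proof.
move=> intl poisN indN t0 mY Y0.
have [incN1 _ _] := poisN.
have incN := nonhomogeneous_poisson_increasing intl incN1.
transitivity (\int[P]_w (\int[P]_w' (real_process N (Y t w) w')%:E))%E.
  apply: (ge0_integral_independent_time incN mY Y0) => A B sA mB.
  by apply: indN => //; apply: sub_sigma_algebra; exists t, B.
apply: eq_integral => w _; apply: (poisson_process_mean poisN).
exact: cumulative_intensity_ge0.
Qed.

Unset Implicit Arguments.

Theorem mainTheorem3 (d : measure_display) (T : measurableType d)
    (R : realType) (P : probability T R)
    (alpha : R) (lambda : R -> R) (N1 : R -> T -> nat) (L : R -> T -> R)
    (g : R -> R) (t : R)
    (Lambda := cumulative_intensity lambda)
    (N := nonhomogeneous_poisson N1 lambda)
    (Y := inverse_process L)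
    (h := inverse_stable_density alpha g) :
  0 < alpha -> alpha < 1 ->
  intensity lambda ->
  poisson_process P 1 N1 ->
  stable_subordinator P alpha L ->
  has_density P (L 1) g ->
  independent_processes P (real_process N) Y ->
  0 < t ->
  [/\ 'E_P[fun w => (N (Y t w) w)%:R] =
        \int[lebesgue_measure]_(x in `]0%R, +oo[) (Lambda x * h t x)%R%:E,
      \int[lebesgue_measure]_(x in `]0%R, +oo[) (Lambda x * h t x)%R%:E =
        \int[lebesgue_measure]_(x in `]0%R, +oo[)
          \int[lebesgue_measure]_(tau in `[0%R, x]) (lambda tau * h t x)%R%:E
    & \int[lebesgue_measure]_(x in `]0%R, +oo[)
          \int[lebesgue_measure]_(tau in `[0%R, x]) (lambda tau * h t x)%R%:E =
        'E_P[fun w => Lambda (Y t w)]]%E.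
Proof.
move=> alpha0 _ intl poisN stableL densL indN t0.
have mY : measurable_fun [set: T] (Y t).
  exact: measurable_inverse_process t stableL.
have Y0 w : 0 <= Y t w by exact: inverse_process_ge0.
have meanN : ('E_P[fun w => (N (Y t w) w)%:R] = 'E_P[fun w => Lambda (Y t w)])%E.
  by rewrite unlock; exact: (poisson_time_change_mean intl poisN indN (ltW t0)).
have meanLambda : ('E_P[fun w => Lambda (Y t w)] =
    \int[lebesgue_measure]_(x in `]0%R, +oo[) (Lambda x * h t x)%R%:E)%E.
  rewrite unlock; apply: (ge0_integral_inverse_process alpha0 stableL densL t0
    (f := EFin \o Lambda)) => [|x].
    by apply/measurable_EFinP; exact: measurable_cumulative_intensity intl.
  by rewrite lee_fin cumulative_intensity_ge0.
have innerE : (\int[lebesgue_measure]_(x in `]0%R, +oo[) (Lambda x * h t x)%R%:E =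
    \int[lebesgue_measure]_(x in `]0%R, +oo[)
      \int[lebesgue_measure]_(tau in `[0%R, x]) (lambda tau * h t x)%R%:E)%E.
  apply: eq_integral => x /set_mem; rewrite /= in_itv/= andbT => x0.
  have [l0 lint] := intl; have [_ g0 _] := densL.
  transitivity ((\int[lebesgue_measure]_(tau in `[0%R, x]) (lambda tau)%:E) *
      (h t x)%:E)%E.
    transitivity ((Lambda x)%:E * (h t x)%:E)%E; first exact: EFinM.
    by congr (_ * _)%E; exact: cumulative_intensityE.
  transitivity (\int[lebesgue_measure]_(tau in `[0%R, x])
      ((lambda tau)%:E * (h t x)%:E))%E; last first.
    by apply: eq_integral => tau _; exact/esym/EFinM.
  apply/esym; apply: ge0_integralZr => //.
  - by have /integrableP[] := lint x (ltW x0).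
  - by move=> u; rewrite /= in_itv/= => /andP[u0 _]; rewrite lee_fin l0.
  - rewrite lee_fin mulr_ge0// divr_ge0 ?(ltW t0)// mulr_ge0 ?powR_ge0//.
    exact: ltW.
by split; rewrite ?meanN ?meanLambda ?innerE.
Qed.
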